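(* Let $D$ be a nonempty finite set of nonzero vectors in $\mathbb{R}^n$. If $\operatorname{cm}(D)\neq\operatorname{cm}_D(D)$, then $\operatorname{pspan}(D)=\operatorname{span}(D)\neq\mathbb{R}^n$.
   Context: $\operatorname{span}(D)$ is the set of finite linear combinations of elements of $D$, and $\operatorname{pspan}(D)=\{\sum_{i=1}^k\lambda_i d_i: k\in\mathbb{N}, d_i\in D,\lambda_i\ge 0\}$. The cosine measure of $D$ and the cosine measure of $D$ relative to $\operatorname{span}(D)$ are $$\operatorname{cm}(D)=\min_{u\in\mathbb{R}^n,\ \|u\|=1}\ \max_{d\in D}\frac{u^\top d}{\|d\|},\qquad \operatorname{cm}_D(D)=\min_{u\in\operatorname{span}(D),\ \|u\|=1}\ \max_{d\in D}\frac{u^\top d}{\|d\|}.$$ *)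

(* Defs.v *)
From HB Require Import structures.
From mathcomp Require Import all_boot all_order all_algebra.
From mathcomp Require Import finmap.
From mathcomp Require Import all_classical all_reals all_analysis.

Set Implicit Arguments.
Unset Strict Implicit.
Unset Printing Implicit Defensive.

Import Order.TTheory GRing.Theory Num.Theory.
Import numFieldNormedType.Exports.

Local Open Scope classical_set_scope.
Local Open Scope ring_scope.

Definition dot (R : realType) (n : nat) (u v : 'rV[R]_n) : R :=
  \sum_(i < n) u 0 i * v 0 i.

(* The library norm `|u| on 'rV[R]_n is the sup norm, hence this definition. *)
Definition enorm (R : realType) (n : nat) (u : 'rV[R]_n) : R :=
  Num.sqrt (dot u u).

(* For nonempty D the supremum is a maximum, see max_cosineP. *)
Definition max_cosine (R : realType) (n : nat) (D : {fset 'rV[R]_n})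
    (u : 'rV[R]_n) : R :=
  sup [set dot u d / enorm d | d in [set` D]].

Definition pspan (R : realType) (n : nat) (D : {fset 'rV[R]_n}) :
    set 'rV[R]_n :=
  [set x | exists (k : nat) (lambda : 'I_k -> R) (d : 'I_k -> 'rV[R]_n),
     [/\ forall i, d i \in D, forall i, 0 <= lambda i
       & x = \sum_(i < k) lambda i *: d i]].

(* The infima are minima, see cmP and cm_relP, when D is nonempty and its
   elements are nonzero. *)
Definition cm (R : realType) (n : nat) (D : {fset 'rV[R]_n}) : R :=
  inf [set max_cosine D u | u in [set u | enorm u = 1]].

Definition cm_rel (R : realType) (n : nat) (D : {fset 'rV[R]_n}) : R :=
  inf [set max_cosine D u | u in [set u | u \in <<D>>%VS /\ enorm u = 1]].

Lemma max_cosineP (R : realType) (n : nat) (D : {fset 'rV[R]_n})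
    (u : 'rV[R]_n) : D != fset0 ->
  exists2 d, d \in D & max_cosine D u = dot u d / enorm d /\
    forall e, e \in D -> dot u e / enorm e <= max_cosine D u.
Proof.
move=> /fset0Pn[d0 d0D]; pose f (d : 'rV[R]_n) := dot u d / enorm d.
have [d dD dmax] : exists2 d, d \in D & forall e, e \in D -> f e <= f d.
  have := @arg_maxP _ R D [` d0D]%fset xpredT (fun x => f (val x)) isT.
  case=> i _ imax; exists (val i); first exact: valP.
  by move=> e eD; exact: (imax [` eD]%fset).
suff maxE : max_cosine D u = f d.
  by exists d => //; split => // e /dmax; rewrite maxE.
apply/eqP; rewrite eq_le; apply/andP; split.
  by apply: ge_sup => [|_ [e /= eD <-]]; [exists (f d); exists d|exact: dmax].
by apply: ub_le_sup; [exists (f d) => _ [e /= eD <-]; exact: dmax|exists d].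
Qed.

Lemma continuous_sum (R : realType) (T : topologicalType)
    (V : normedModType R) (I : Type) (r : seq I) (f : I -> T -> V) :
  (forall i, continuous (f i)) -> continuous (fun x => \sum_(i <- r) f i x).
Proof.
move=> fc; apply: (@continuous_big V I +%R 0 xpredT) => [|i _]; last exact: fc.
exact: add_continuous.
Qed.

Lemma continuous_dot (R : realType) (n : nat) (d : 'rV[R]_n) :
  continuous (fun u => dot u d).
Proof.
apply: (@continuous_sum R 'rV[R]_n R^o 'I_n _
  (fun i u => u 0 i * d 0 i)) => i u.
by apply: continuousM; [exact: coord_continuous|exact: cst_continuous].
Qed.

Lemma continuous_enorm (R : realType) (n : nat) : continuous (@enorm R n).
Proof.
move=> u; apply: (@continuous_comp _ _ _ (fun v => dot v v) Num.sqrt); last first.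
  exact: sqrt_continuous.
move: u; apply: (@continuous_sum R 'rV[R]_n R^o 'I_n _
  (fun i u => u 0 i * u 0 i)) => i u.
by apply: continuousM; exact: coord_continuous.
Qed.

Lemma continuous_max_cosine (R : realType) (n : nat) (D : {fset 'rV[R]_n}) :
  D != fset0 -> continuous (max_cosine D).
Proof.
move=> D0; have /fset0Pn[d0 d0D] := D0.
pose f (d u : 'rV[R]_n) : R^o := dot u d / enorm d.
have fc d : continuous (f d).
  move=> u; apply: (@continuousM R 'rV[R]_n (fun u => dot u d) (fun=> _)).
    exact: continuous_dot.
  exact: cst_continuous.
have -> : max_cosine D = fun u => \big[Num.max/f d0 u]_(d <- D) f d u.
  apply/funext => u; have [d dD [maxE dmax]] := max_cosineP u D0.
  apply/eqP; rewrite eq_le; apply/andP; split.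
    by rewrite maxE (le_bigmax_seq (f d0 u) d xpredT).
  rewrite big_seq; apply: bigmax_le; first exact: dmax.
  by move=> e eD; exact: dmax.
elim: (enum_fset D) => [|d r IH].
  rewrite (_ : (fun _ => _) = f d0) //; apply/funext => u; exact: big_nil.
pose g u := \big[Num.max/f d0 u]_(e <- r) f e u.
rewrite (_ : (fun _ => _) = f d \max g); last first.
  by apply/funext => u; exact: big_cons.
by move=> u; apply: continuous_max; [exact: fc|exact: IH].
Qed.

Lemma closed_vspace (R : realType) (n : nat) (V : {vspace 'rV[R]_n}) :
  closed [set u | u \in V].
Proof.
have -> : [set u | u \in V] = (fun u => projv V u - u) @^-1` [set 0].
  apply/seteqP; split => u /=; first by move=> /projv_id ->; rewrite subrr.
  by move=> /eqP; rewrite subr_eq0 => /eqP <-; exact: memv_proj.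
have projc : continuous (projv V : 'rV[R]_n -> 'rV[R]_n).
  pose f i (u : 'rV[R]_n) := u 0 i *: projv V (delta_mx 0 i).
  rewrite (_ : (projv V : _ -> _) = fun u => \sum_(i < n) f i u); last first.
    apply/funext => u; rewrite {1}(row_sum_delta u) linear_sum.
    by apply: eq_bigr => i _; rewrite linearZ.
  apply: continuous_sum => i u; apply: continuousZr_tmp.
  exact: coord_continuous.
apply: preimage_closed => [u _|].
  by apply: continuousB; [exact: projc|exact: cvg_id].
exact/accessible_closed_set1/hausdorff_accessible/norm_hausdorff.
Qed.

Lemma compact_unit_sphere (R : realType) (n : nat) (V : {vspace 'rV[R]_n}) :
  compact [set u | u \in V /\ enorm u = 1].
Proof.
apply: bounded_closed_compact.
  exists 1; split => // M M1 u [_ u1]; apply: le_trans (ltW M1).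
  rewrite [leLHS]/Num.norm /= mx_normrE; apply/bigmax_leP.
  split => //= -[i j] _ /=.
  rewrite ord1 -sqrtr_sqr -u1 ler_sqrt.
    rewrite /dot (bigD1 j) //= expr2 lerDl sumr_ge0// => k _.
    by rewrite -expr2 sqr_ge0.
  by apply: sumr_ge0 => k _; rewrite -expr2 sqr_ge0.
apply: closedI; first exact: closed_vspace.
apply: (@preimage_closed _ _ (@enorm R n) [set 1]); last exact: closed_eq.
by move=> u _; exact: continuous_enorm.
Qed.

Lemma enorm_gt0 (R : realType) (n : nat) (u : 'rV[R]_n) :
  u != 0 -> 0 < enorm u.
Proof.
have dge0 i : true -> 0 <= u 0 i * u 0 i by rewrite -expr2 sqr_ge0.
move=> u0; rewrite sqrtr_gt0 lt_neqAle sumr_ge0// andbT eq_sym.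
apply: contra u0; rewrite psumr_eq0// => /allP u0; apply/eqP/rowP => i.
by rewrite mxE; have := u0 i (mem_index_enum _); rewrite /= -expr2 sqrf_eq0 => /eqP.
Qed.

Lemma enormZ (R : realType) (n : nat) (a : R) (u : 'rV[R]_n) :
  enorm (a *: u) = `|a| * enorm u.
Proof.
rewrite /enorm -sqrtr_sqr -sqrtrM ?sqr_ge0//; congr Num.sqrt.
by rewrite /dot big_distrr /=; apply: eq_bigr => i _; rewrite !mxE mulrACA expr2.
Qed.

Lemma min_max_cosineP (R : realType) (n : nat) (D : {fset 'rV[R]_n})
    (V : {vspace 'rV[R]_n}) :
  D != fset0 -> 0 \notin D -> {subset D <= V} ->
  exists2 u, u \in V /\ enorm u = 1 &
    inf [set max_cosine D v | v in [set v | v \in V /\ enorm v = 1]] =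
      max_cosine D u /\
    forall v, v \in V -> enorm v = 1 -> max_cosine D u <= max_cosine D v.
Proof.
move=> D0 nD DV; have /fset0Pn[d dD] := D0.
have d_gt0 : 0 < enorm d by apply: enorm_gt0; apply: contraNneq nD => <-.
have S0 : [set v | v \in V /\ enorm v = 1] !=set0.
  exists ((enorm d)^-1 *: d); split; first by rewrite memvZ// DV.
  by rewrite enormZ gtr0_norm ?invr_gt0// mulVf ?gt_eqF.
have [u + umin] := EVT_min_rV S0 (@compact_unit_sphere R n V)
  (continuous_subspaceT (continuous_max_cosine D0)).
rewrite inE => uS; have {}umin v : v \in V -> enorm v = 1 ->
    max_cosine D u <= max_cosine D v by move=> vV v1; apply: umin; rewrite inE.
exists u => //; split=> //; apply/eqP; rewrite eq_le; apply/andP; split.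
  by apply: ge_inf; [exists (max_cosine D u) => _ [v [vV v1] <-]; exact: umin|exists u].
by apply: lb_le_inf; [exists (max_cosine D u), u|move=> _ [v [vV v1] <-]; exact: umin].
Qed.

Lemma cmP (R : realType) (n : nat) (D : {fset 'rV[R]_n}) :
  D != fset0 -> 0 \notin D ->
  exists2 u, enorm u = 1 & cm D = max_cosine D u /\
    forall v, enorm v = 1 -> cm D <= max_cosine D v.
Proof.
move=> D0 nD.
have [|u [_ u1] [E umin]] := @min_max_cosineP R n D fullv D0 nD.
  by move=> d _; rewrite memvf.
have cmE : cm D = max_cosine D u.
  rewrite -E /cm; congr (inf (_ @` _)); apply/seteqP.
  by split => [v v1|v []//]; rewrite /= memvf.
by exists u => //; split => // v v1; rewrite cmE umin// memvf.
Qed.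

Lemma cm_relP (R : realType) (n : nat) (D : {fset 'rV[R]_n}) :
  D != fset0 -> 0 \notin D ->
  exists2 u, u \in <<D>>%VS /\ enorm u = 1 & cm_rel D = max_cosine D u /\
    forall v, v \in <<D>>%VS -> enorm v = 1 -> cm_rel D <= max_cosine D v.
Proof.
move=> D0 nD.
have [|u uS [E umin]] := @min_max_cosineP R n D <<D>>%VS D0 nD.
  by move=> d dD; exact: memv_span.
by exists u => //; rewrite /cm_rel E.
Qed.

(* Main.v *)
Require Import Defs.
From HB Require Import structures.
From mathcomp Require Import all_boot all_order all_algebra.
From mathcomp Require Import finmap.
From mathcomp Require Import all_classical all_reals all_analysis.
From mathcomp Require Import ring lra.

Set Implicit Arguments.
Unset Strict Implicit.
Unset Printing Implicit Defensive.

Import Order.TTheory GRing.Theory Num.Theory.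
Import numFieldNormedType.Exports.

Local Open Scope classical_set_scope.
Local Open Scope ring_scope.

(** If [D] spans the whole space, the two cosine measures are minima over the
same set, so [cm D <> cm_rel D] forces the span to be proper.  The remaining
claim, [pspan D = span D], follows from a dichotomy on the sign of [cm_rel D].

- If [cm_rel D <= 0], then [cm D = cm_rel D] ([cm_eq_cm_rel]).  A unit vector
  [u] has the same inner products with [D] as its orthogonal projection [p] on
  the span, so its largest cosine is [enorm p] times that of a unit vector of
  the span (or zero, if [p = 0]).  As [enorm p <= 1], shrinking a number that
  is at least [cm_rel D <= 0] by this factor keeps it at least [cm_rel D].

- If [c = cm_rel D > 0], then every nonzero [r] in the span makes an angle of
  cosine at least [c] with some [d] in [D], so that subtracting from [r] its
  component along [d] shortens it by at least a fixed factor.  Iterating this would write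
  any [x] of the span as an infinite nonnegative combination of [D].
  The iteration is replaced by a single minimisation: among nonnegative
  coefficients [l], minimise the length of the residual [x - \sum l_i d_i] plus
  a small multiple of [\sum l_i |d_i|].  The penalty makes the problem coercive,
  so a minimiser exists, and it is small enough for the step above to decrease
  the objective as long as the residual is nonzero
  ([nonneg_combination_of_cosine_bound]).  Hence the residual vanishes. *)

(** * The Euclidean inner product *)

Section Dot.
Variables (R : realType) (n : nat).
Implicit Types (u v w : 'rV[R]_n) (a : R).

Lemma dotC u v : dot u v = dot v u.
Proof. by apply: eq_bigr => i _; rewrite mulrC. Qed.

Lemma dotDl u v w : dot (u + v) w = dot u w + dot v w.
Proof. by rewrite -big_split; apply: eq_bigr => i _; rewrite mxE mulrDl. Qed.

Lemma dotZl a u w : dot (a *: u) w = a * dot u w.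
Proof. by rewrite /dot mulr_sumr; apply: eq_bigr => i _; rewrite mxE mulrA. Qed.

Lemma dotBl u v w : dot (u - v) w = dot u w - dot v w.
Proof. by rewrite dotDl -scaleN1r dotZl mulN1r. Qed.

Lemma dot0l w : dot 0 w = 0.
Proof. by rewrite -(scale0r w) dotZl mul0r. Qed.

Lemma dot_suml (I : Type) (r : seq I) (F : I -> 'rV[R]_n) w :
  dot (\sum_(i <- r) F i) w = \sum_(i <- r) dot (F i) w.
Proof.
by apply: (big_morph (fun u => dot u w)) => [u v|]; [exact: dotDl|exact: dot0l].
Qed.

Lemma enorm_ge0 u : 0 <= enorm u.
Proof. exact: sqrtr_ge0. Qed.

Lemma sqr_enorm u : enorm u ^+ 2 = dot u u.
Proof.
by rewrite sqr_sqrtr// /dot sumr_ge0// => i _; rewrite -expr2 sqr_ge0.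
Qed.

Lemma dot_span0 (X : seq 'rV[R]_n) w v :
  (forall d, d \in X -> dot w d = 0) -> v \in <<X>>%VS -> dot w v = 0.
Proof.
move=> sw vs; rewrite (coord_span (X := in_tuple X) vs) dotC dot_suml.
by apply: big1 => i _; rewrite dotZl dotC sw ?mulr0// mem_nth.
Qed.

(** Gram-Schmidt: a new vector [d] enters the projection only through its
component [e] orthogonal to the previous span. *)
Lemma orthogonal_projection (X : seq 'rV[R]_n) u :
  exists2 p, p \in <<X>>%VS & forall v, v \in <<X>>%VS -> dot (u - p) v = 0.
Proof.
suff [p ps up] : exists2 p, p \in <<X>>%VS &
    forall d, d \in X -> dot (u - p) d = 0.
  by exists p => // v; exact: dot_span0.
elim: X u => [|d X IH] u; first by exists 0; rewrite ?mem0v.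
have [p ps up] := IH u; have [q qs dq] := IH d.
pose e := d - q; pose a := dot u e / dot e e.
have sub v : v \in <<X>>%VS -> v \in << d :: X >>%VS.
  by move=> vs; rewrite span_cons -[v]add0r memv_add ?mem0v.
exists (p + a *: e).
  by rewrite memvD ?(sub p)// memvZ// memvB ?(sub q)// memv_span ?mem_head.
have up0 x : x \in X -> dot (u - (p + a *: e)) x = 0.
  by move=> xs; rewrite opprD addrA dotBl up// dotZl dq// mulr0 subr0.
move=> x; rewrite inE => /predU1P[->|]; last exact: up0.
rewrite -(subrK q d) dotC dotDl -/e [dot q _]dotC (dot_span0 up0 qs) addr0.
rewrite dotC dotBl dotDl dotZl [dot p e]dotC (dot_span0 dq ps) add0r.
have [e0|e0] := eqVneq e 0; first by rewrite e0 !(dotC _ 0) !dot0l mulr0 subr0.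
by rewrite divfK ?subrr// -sqr_enorm expf_neq0// gt_eqF// enorm_gt0.
Qed.

Lemma enorm_projection_le u p : dot (u - p) p = 0 -> enorm p <= enorm u.
Proof.
move=> up; rewrite -(@ler_pXn2r _ 2) ?nnegrE ?enorm_ge0// !sqr_enorm.
have := sqr_ge0 (enorm (u - p)); rewrite sqr_enorm.
move: up; rewrite !dotBl [dot u (u - p)]dotC [dot p (u - p)]dotC !dotBl (dotC p u).
lra.
Qed.

(** Removing from [r] its component along [d] shortens it by a definite
proportion of the length of that component: with [t = dot r d / enorm d], the
squared length drops by [t ^+ 2], hence the length by at least
[t ^+ 2 / (2 * enorm r) >= c * t / 2]; half of this rate makes the inequality
strict. *)
Lemma enorm_sub_component (r d : 'rV[R]_n) c :
  0 < c -> r != 0 -> d != 0 -> c * enorm r <= dot r d / enorm d ->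
  enorm (r - (dot r d / enorm d ^+ 2) *: d) + c / 4 * (dot r d / enorm d)
    < enorm r.
Proof.
move=> c0 r0 d0; have rp := enorm_gt0 r0; have dp := enorm_gt0 d0.
set t := dot r d / enorm d => ct; set r' := r - _.
have r'E : enorm r' ^+ 2 = enorm r ^+ 2 - t ^+ 2.
  rewrite !sqr_enorm /r' /t dotBl dotZl [dot r (_ - _)]dotC [dot d (_ - _)]dotC.
  rewrite !dotBl !dotZl (dotC d r) -(sqr_enorm d); field.
  by rewrite gt_eqF.
have tp : 0 < t by apply: lt_le_trans ct; rewrite mulr_gt0.
have r'0 := enorm_ge0 r'.
have r'r : enorm r' <= enorm r.
  by rewrite -(@ler_pXn2r _ 2) ?nnegrE ?enorm_ge0// r'E gerBl sqr_ge0.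
rewrite ltNge; apply/negP => H.
have h1 : (enorm r - enorm r') * (enorm r + enorm r') <=
    (c / 4 * t) * (2 * enorm r) by apply: ler_pM; lra.
have h2 : t * (c * enorm r) <= t * t by rewrite ler_pM2l.
have h3 : 0 < t * t by rewrite mulr_gt0.
move: r'E; rewrite !expr2; lra.
Qed.

End Dot.

(** * Positive relative cosine measure *)

Section PositiveSpanning.
Variables (R : realType) (n k : nat) (d : 'I_k -> 'rV[R]_n).

Let residual x (l : 'rV[R]_k) := x - \sum_(i < k) l 0 i *: d i.

Let objective x b (l : 'rV[R]_k) : R :=
  enorm (residual x l) + \sum_(i < k) l 0 i * (b * enorm (d i)).

Let continuous_objective x b : continuous (objective x b).
Proof.
have coordc (i : 'I_k) : continuous (fun l : 'rV[R]_k => l 0 i : R^o).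
  by move=> l; exact: coord_continuous.
move=> l; apply: (@continuousD R R^o 'rV[R]_k (fun l => enorm (residual x l))
  (fun l => \sum_(i < k) l 0 i * (b * enorm (d i)))).
  apply: (@continuous_comp _ _ _ (residual x) (@enorm R n)); last first.
    exact: continuous_enorm.
  apply: continuousB; first exact: cst_continuous.
  move: l; apply: continuous_sum => i l; apply: continuousZr_tmp.
  exact: coordc.
move: l; apply: (@continuous_sum R 'rV[R]_k R^o 'I_k _
  (fun i l => l 0 i * (b * enorm (d i)))) => i l.
by apply: continuousZr_tmp; exact: coordc.
Qed.

(** A Farkas lemma in quantitative form, where a uniform lower bound on the
cosines takes the place of a separation argument.  If the minimiser [l] of the penalised
problem left a nonzero residual, raising the coefficient of a well-aligned
[d i] would shorten the residual by more than it costs in penalty. *)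
Lemma nonneg_combination_of_cosine_bound (V : {vspace 'rV[R]_n}) (c : R) x :
  0 < c -> (forall i, d i \in V) -> (forall i, d i != 0) ->
  (forall r, r \in V -> r != 0 ->
     exists i, c * enorm r <= dot r (d i) / enorm (d i)) ->
  x \in V ->
  exists2 l : 'I_k -> R, forall i, 0 <= l i & x = \sum_(i < k) l i *: d i.
Proof.
move=> c0 dV d0 cosV xV.
(* The rate that [enorm_sub_component] offsets. *)
pose b := c / 4; have b0 : 0 < b by rewrite divr_gt0.
have dp i := enorm_gt0 (d0 i).
pose box := [set l : 'rV[R]_k |
  forall i, [set` `[0, enorm x / (b * enorm (d i))]] (l 0 i)].
have box_compact : compact box.
  by apply: (rV_compact (A := fun i => [set` `[0, enorm x / (b * enorm (d i))]]))
    => i; exact: segment_compact.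
(* Sublevel sets of the objective lie in the box, by nonnegativity of terms:
this is the coercivity given by the penalty. *)
have boxP (l : 'rV[R]_k) :
    (forall i, 0 <= l 0 i) -> objective x b l <= enorm x -> box l.
  move=> l0 lx i; rewrite /= in_itv /= l0 /= ler_pdivlMr ?mulr_gt0//.
  apply: le_trans lx.
  apply: (@le_trans _ _ (\sum_(j < k) l 0 j * (b * enorm (d j)))).
    rewrite (bigD1 i)//= lerDl sumr_ge0// => j _.
    by rewrite mulr_ge0// mulr_ge0 ?enorm_ge0// ltW.
  by rewrite lerDr enorm_ge0.
have obj0 : objective x b 0 = enorm x.
  rewrite /objective /residual !big1 ?subr0 ?addr0// => i _.
    by rewrite mxE mul0r.
  by rewrite mxE scale0r.
have box0 : box 0 by apply: boxP => [i|]; rewrite ?mxE ?obj0.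
have [l /[!inE] lbox lmin] := EVT_min_rV (ex_intro _ _ box0) box_compact
  (continuous_subspaceT (@continuous_objective x b)).
have l0 i : 0 <= l 0 i by have := lbox i; rewrite /= in_itv /= => /andP[].
exists (l 0) => //; apply/eqP; rewrite -subr_eq0 -/(residual x l).
apply/negP => /negP r0.
have rV : residual x l \in V.
  by rewrite memvB// memv_suml// => i _; rewrite memvZ.
have [i ci] := cosV _ rV r0.
have := enorm_sub_component c0 r0 (d0 i) ci.
set t := dot _ _ / _ ^+ 2; have tE : dot (residual x l) (d i) / enorm (d i) =
    t * enorm (d i) by rewrite /t; field; rewrite gt_eqF.
have t0 : 0 <= t.
  rewrite -(pmulr_lge0 _ (dp i)) -tE; apply: le_trans ci.
  by rewrite mulr_ge0 ?enorm_ge0// ltW.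
rewrite tE => step.
pose l' := l + t *: delta_mx 0 i.
have l'E (U : lmodType R) (F : 'I_k -> U) :
    \sum_(j < k) l' 0 j *: F j = \sum_(j < k) l 0 j *: F j + t *: F i.
  rewrite (eq_bigr (fun j => l 0 j *: F j + (t * (j == i)%:R) *: F j)); last first.
    by move=> j _; rewrite !mxE eqxx scalerDl.
  rewrite big_split /=; congr (_ + _); rewrite (bigD1 i)//= eqxx mulr1.
  by rewrite big1 ?addr0// => j /negPf ->; rewrite mulr0 scale0r.
have lt_obj : objective x b l' < objective x b l.
  rewrite /objective /residual l'E.
  rewrite (l'E R^o (fun j => b * enorm (d j))) opprD [x + _]addrA.
  by rewrite addrA [ltLHS]addrAC ltrD2r [_ *: (b * _)]mulrCA.
have l'0 j : 0 <= l' 0 j by rewrite !mxE addr_ge0// mulr_ge0// ler0n.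
have l'box : box l'.
  by apply: boxP => //; rewrite -obj0 (le_trans (ltW lt_obj))// lmin// inE.
by have := lmin l'; rewrite inE leNgt lt_obj => /(_ l'box).
Qed.

End PositiveSpanning.

(** * Cosine measures *)

Section CosineMeasure.
Variables (R : realType) (n : nat) (D : {fset 'rV[R]_n}).
Hypotheses (D_neq0 : D != fset0) (D_nonzero : 0 \notin D).

Lemma eq_max_cosine u v :
  (forall d, d \in D -> dot u d = dot v d) -> max_cosine D u = max_cosine D v.
Proof.
move=> uv; rewrite /max_cosine; congr sup.
by apply: eq_imagel => d dD /=; rewrite uv.
Qed.

Lemma max_cosineZ a u : 0 <= a -> max_cosine D (a *: u) = a * max_cosine D u.
Proof.
have cosZ d : dot (a *: u) d / enorm d = a * (dot u d / enorm d).
  by rewrite dotZl mulrA.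
move=> a0; have [d dD [ZE Zmax]] := max_cosineP (a *: u) D_neq0.
have [e eD [uE umax]] := max_cosineP u D_neq0.
apply/eqP; rewrite eq_le; apply/andP; split.
  by rewrite ZE cosZ ler_wpM2l ?umax.
by rewrite uE -cosZ Zmax.
Qed.

(** The homogeneous form of the minimality of [cm_rel D]; it also covers the
zero projections of vectors orthogonal to [D]. *)
Lemma cm_rel_enorm_le p :
  p \in <<D>>%VS -> cm_rel D * enorm p <= max_cosine D p.
Proof.
move=> pD; have [p0|p0] := eqVneq (enorm p) 0.
  suff -> : p = 0 *: p by rewrite max_cosineZ// enormZ normr0 !mul0r mulr0.
  rewrite scale0r; apply/eqP; apply: contra_eqT p0 => p0.
  by rewrite gt_eqF ?enorm_gt0.
have [_ _ [_ rel_min]] := cm_relP D_neq0 D_nonzero.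
rewrite -[in leRHS](scale1r p) -(divff p0) -scalerA max_cosineZ ?enorm_ge0//.
rewrite mulrC ler_wpM2l ?enorm_ge0// rel_min ?memvZ// enormZ.
by rewrite ger0_norm ?invr_ge0 ?enorm_ge0// mulVf.
Qed.

(** When [cm_rel D] is negative or zero, the bound [cm_rel D * enorm p] only
improves on [cm_rel D] as the projection [p] of a unit vector gets shorter. *)
Lemma cm_eq_cm_rel : cm_rel D <= 0 -> cm D = cm_rel D.
Proof.
move=> rel_le0; have [u u1 [cmE cm_min]] := cmP D_neq0 D_nonzero.
have [v [_ v1] [relE _]] := cm_relP D_neq0 D_nonzero.
apply/eqP; rewrite eq_le {1}relE cm_min//= cmE.
have [p pD up] := orthogonal_projection D u.
rewrite (@eq_max_cosine u p) => [|d dD]; last first.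
  by apply/eqP; rewrite -subr_eq0 -dotBl up// memv_span.
apply: le_trans (cm_rel_enorm_le pD).
by rewrite ler_niMr// -u1 enorm_projection_le// up.
Qed.

Lemma span_sub_pspan :
  0 < cm_rel D -> [set u | u \in <<D>>%VS] `<=` pspan D.
Proof.
move=> rel_gt0 x xD; pose d (i : 'I_(size D)) := D`_i.
have dD i : d i \in D by exact: mem_nth.
have [|i|r rD r0|l l0 xE] :=
    nonneg_combination_of_cosine_bound rel_gt0 (d := d) _ _ _ xD.
- by move=> i; rewrite memv_span.
- by apply: contraNneq D_nonzero => <-.
- have [e eD [rE _]] := max_cosineP r D_neq0.
  have iD : (index e D < size D)%N by rewrite index_mem.
  by exists (Ordinal iD); rewrite /d nth_index// -rE cm_rel_enorm_le.
- by exists (size D), l, d; split.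
Qed.

End CosineMeasure.

Lemma pspan_sub_span (R : realType) (n : nat) (D : {fset 'rV[R]_n}) :
  pspan D `<=` [set u | u \in <<D>>%VS].
Proof.
move=> _ [k [l [d [dD _ ->]]]] /=.
by apply: memv_suml => i _; rewrite memvZ// memv_span.
Qed.

Theorem theorem24 (R : realType) (n : nat) (D : {fset 'rV[R]_n})
    (D_neq0 : D != fset0) (D_nonzero : forall d, d \in D -> d != 0)
    (cm_neq : cm D <> cm_rel D) :
  pspan D = [set u | u \in <<D>>%VS] /\ [set u | u \in <<D>>%VS] <> [set: 'rV[R]_n].
Proof.
have nD : 0 \notin D by apply/negP => /D_nonzero; rewrite eqxx.
split.
  apply/seteqP; split; first exact: pspan_sub_span.
  apply: span_sub_pspan => //; rewrite ltNge; apply/negP => rel_le0.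
  exact/cm_neq/cm_eq_cm_rel.
move=> spanT; apply: cm_neq; rewrite /cm /cm_rel; congr (inf (_ @` _)).
apply/seteqP; split => [u u1|u []//]; split=> //.
by have : [set: 'rV[R]_n] u by []; rewrite -spanT.
Qed.
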